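(* Let $R$ be a commutative ring and work in the category $\mathcal{C}ob_{/l}$ over $R$. Let $\Sigma$ be a cobordism and let $A$ and $B$ be two distinct connected components of $\Sigma$. Let $\Sigma_A$ (respectively $\Sigma_B$) be the cobordism obtained from $\Sigma$ by increasing the genus of $A$ (respectively of $B$) by $2$, leaving everything else unchanged. Then, modulo the 4TU relation, $\Sigma_A=\Sigma_B$; in particular $\Sigma_A=\Sigma_B$ in $\mathcal{C}ob_{/l}$. In other words, a surface with a 2-handle on one of its connected components is equal to the same surface with the 2-handle removed and glued on a different component.
   Context: The category $\mathcal{C}ob_{/l}$ over a commutative ground ring $R$: objects are finite (possibly empty) disjoint unions of circles $\bigcirc^n$, $n\ge 0$ ($\bigcirc^0=\emptyset$). Morphisms from $\bigcirc^n$ to $\bigcirc^m$ are formal $R$-linear combinations of compact orientable 2-dimensional cobordisms from $\bigcirc^n$ to $\bigcirc^m$ (abstract surfaces, not necessarily connected, possibly with closed components; circles and cobordisms are oriented compatibly with gluing and cobordisms are taken up to homeomorphism fixing the boundary, so a cobordism is determined by the partition of its boundary circles into connected components, the genus of each component, and the genera of its closed components), modulo the following local relations. Composition is gluing, extended bilinearly. - 4TU: if $D_1,D_2,D_3,D_4$ are four disjoint disks in the interior of a (not necessarily connected) cobordism $C$ and $C_{ij}$ denotes the cobordism obtained from $C$ by removing $D_i$ and $D_j$ and gluing in a tube (annulus, compatible with orientations) with the same boundary, then $C_{12}+C_{34}=C_{13}+C_{24}$. - S: a cobordism with a connected component that is a sphere equals $0$. - T: a connected component that is a torus may be removed and replaced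 by the factor $2$. A ''2-handle'' on a surface means two handles on the same component, i.e. a piece of the surface of genus 2 with one boundary circle. *)

(* Defs.v *)
From HB Require Import structures.
From mathcomp Require Import all_boot all_order all_algebra.
From mathcomp Require Import boolp.
From mathcomp.multinomials Require Import monalg.

Set Implicit Arguments.
Unset Strict Implicit.
Unset Printing Implicit Defensive.

Import GRing.Theory.
Local Open Scope ring_scope.
Local Open Scope quotient_scope.

(* A cobordism from n circles to m circles, presented by its finite
   set 'I_ncomp of connected components, their genera, and the component on
   which each boundary circle lies.  A component outside the range of bdry is
   closed. *)

Record surface (n m : nat) := Surface {
  ncomp : nat;
  genus : {ffun 'I_ncomp -> nat};
  bdry : {ffun 'I_n + 'I_m -> 'I_ncomp}
}.

Notation component C := 'I_(ncomp C).

Section SurfaceChoice.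
Variables n m : nat.

Definition surface_code (C : surface n m) :
    {k : nat & ({ffun 'I_k -> nat} * {ffun 'I_n + 'I_m -> 'I_k})%type} :=
  existT _ (ncomp C) (genus C, bdry C).

Definition surface_decode
    (c : {k : nat & ({ffun 'I_k -> nat} * {ffun 'I_n + 'I_m -> 'I_k})%type}) :
    surface n m :=
  Surface (tagged c).1 (tagged c).2.

Lemma surface_codeK : cancel surface_code surface_decode.
Proof. by case. Qed.

HB.instance Definition _ := Choice.copy (surface n m) (can_type surface_codeK).

End SurfaceChoice.

Section Cobordisms.
Variables n m : nat.
Implicit Types C : surface n m.

(* Homeomorphism relative to the boundary, by the classification of compact
   oriented surfaces. *)
Definition homeo C C' : Prop :=
  exists f : component C -> component C',
    [/\ bijective f,
        forall x, genus C' (f x) = genus C x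
      & forall e, bdry C' e = f (bdry C e)].

Definition homeob C C' : bool := `[< homeo C C' >].

Lemma homeob_equiv : equiv_class_of homeob.
Proof.
split=> [C|C C'|C C' C''].
- by apply/asboolP; exists id; split=> //; exists id.
- have hsym D D' : homeob D D' -> homeob D' D.
    case/asboolP=> f [[g fK gK] fg fb]; apply/asboolP; exists g; split.
    + by exists f.
    + by move=> x; rewrite -fg gK.
    + by move=> e; rewrite fb fK.
  by apply/idP/idP; apply: hsym.
- case/asboolP=> f [fbij fg fb] /asboolP[g [gbij gg gb]].
  apply/asboolP; exists (g \o f); split.
  + exact: bij_comp.
  + by move=> x /=; rewrite gg fg.
  + by move=> e /=; rewrite gb fb.
Qed.

Canonical homeob_equivRel := EquivRelPack homeob_equiv.

Definition cobordism : Type := {eq_quot homeob}.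
HB.instance Definition _ := Choice.on cobordism.

Definition cob_of C : cobordism := \pi_({eq_quot homeob}) C.

Definition add_genus C (A : component C) (g : nat) : surface n m :=
  Surface [ffun x => (genus C x + (if x == A then g else 0))%N] (bdry C).

(* Disjoint union with a closed connected surface of genus g. Up to
   homeomorphism, every surface with a closed component has this form. *)
Definition add_closed C (g : nat) : surface n m :=
  @Surface n m (ncomp C).+1
    [ffun x => if unlift ord_max x is Some y then genus C y else g]
    [ffun e => lift ord_max (bdry C e)].

(* Remove a disk in the interior of component a and one in component b, and
   glue in a tube.  If a = b this adds a handle to a.  Otherwise it replaces a
   and b by their connected sum: component b is deleted from the index set
   (lift b enumerates the remaining ones) and its genus and its boundary
   circles are transferred to a, which is lift b a'. *)
Definition tube C (a b : component C) : surface n m :=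
  if unlift b a is Some a' then
    @Surface n m (ncomp C).-1
      [ffun x => (genus C (lift b x) + (if x == a' then genus C b else 0))%N]
      [ffun e => odflt a' (unlift b (bdry C e))]
  else add_genus a 1.

End Cobordisms.

(* The lmodType instance of monalg is not used since it excludes the zero
   ring. *)

Definition freemod (R : pzRingType) (K : choiceType) : Type := {malg R[K]}.

Section FreeModule.
Variables (R : pzRingType) (K : choiceType).

HB.instance Definition _ := GRing.Zmodule.on (freemod R K).

Definition freemod_scale (c : R) (v : freemod R K) : freemod R K :=
  [malg k in msupp v => c * v@_k].

Lemma freemod_scaleE c v k : (freemod_scale c v)@_k = c * v@_k.
Proof. by rewrite mcoeffE; case: msuppP; rewrite ?mulr0. Qed.

Fact freemod_scaleA a b v :
  freemod_scale a (freemod_scale b v) = freemod_scale (a * b) v.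
Proof. by apply/malgP=> k; rewrite !freemod_scaleE mulrA. Qed.

Fact freemod_scale1 : left_id 1 freemod_scale.
Proof. by move=> v; apply/malgP=> k; rewrite freemod_scaleE mul1r. Qed.

Fact freemod_scaleDr : right_distributive freemod_scale +%R.
Proof.
by move=> c u v; apply/malgP=> k; rewrite !(freemod_scaleE, mcoeffD) mulrDr.
Qed.

Fact freemod_scaleDl v : {morph freemod_scale^~ v : a b / a + b}.
Proof.
by move=> a b; apply/malgP=> k; rewrite !(freemod_scaleE, mcoeffD) mulrDl.
Qed.

HB.instance Definition _ := GRing.Zmodule_isLmodule.Build R (freemod R K)
  freemod_scaleA freemod_scale1 freemod_scaleDr freemod_scaleDl.

Definition basis_vec (k : K) : freemod R K := << 1 *g k >>.

End FreeModule.

Section QuotientModule.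
Variables (R : pzRingType) (V : lmodType R) (P : V -> Prop).

Definition submod_span : {pred V} := fun v =>
  `[< exists (k : nat) (a : 'I_k -> R) (w : 'I_k -> V),
        (forall i, P (w i)) /\ v = \sum_i a i *: w i >].

Lemma submod_spanZ c v : submod_span v -> submod_span (c *: v).
Proof.
case/asboolP=> k [a [w [Pw ->]]]; apply/asboolP.
exists k, (fun i => c * a i), w; split=> //.
by rewrite scaler_sumr; apply: eq_bigr => i _; rewrite scalerA.
Qed.

Lemma submod_spanD u v : submod_span u -> submod_span v -> submod_span (u + v).
Proof.
case/asboolP=> k [a [w [Pw ->]]] /asboolP[l [b [x [Px ->]]]]; apply/asboolP.
exists (k + l)%N, (fun i => match split i with inl j => a j | inr j => b j end),
  (fun i => match split i with inl j => w j | inr j => x j end); split.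
  by move=> i; case: (split i).
rewrite big_split_ord /=; congr (_ + _); apply: eq_bigr => i _.
  by rewrite (unsplitK (inl i)).
by rewrite (unsplitK (inr i)).
Qed.

Lemma submod_span_zmod_closed : zmod_closed submod_span.
Proof.
split=> [|u v hu hv]; first apply/asboolP.
  exists 0%N, (fun=> 0), (fun=> 0); split; first by case.
  by rewrite big_ord0.
by apply: submod_spanD => //; rewrite -scaleN1r; apply: submod_spanZ.
Qed.

HB.instance Definition _ := GRing.isZmodClosed.Build V submod_span submod_span_zmod_closed.

Definition submod_span_closed : zmodClosed V := submod_span.

Definition quotmod : Type := Quotient.quot submod_span_closed.

HB.instance Definition _ := Choice.on quotmod.
HB.instance Definition _ := GRing.Zmodule.on quotmod.

Definition quotmod_pi (v : V) : quotmod := \pi_(Quotient.quot submod_span_closed) v.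

Lemma quotmod_eqP u v : quotmod_pi u = quotmod_pi v <-> submod_span (u - v).
Proof.
rewrite /quotmod_pi; split=> [h|h].
  by have := Quotient.idealrBE submod_span_closed u v; rewrite h eqxx.
by apply/eqP; rewrite -(Quotient.idealrBE submod_span_closed).
Qed.

Lemma quotmod_piD u v : quotmod_pi (u + v) = quotmod_pi u + quotmod_pi v.
Proof. exact: raddfD. Qed.

Definition quotmod_scale (c : R) (x : quotmod) : quotmod :=
  quotmod_pi (c *: repr (x : Quotient.quot submod_span_closed)).

Lemma quotmod_piZ c v : quotmod_scale c (quotmod_pi v) = quotmod_pi (c *: v).
Proof.
apply/quotmod_eqP; rewrite -scalerBr; apply: submod_spanZ; apply/quotmod_eqP.
exact: reprK.
Qed.

Lemma quotmod_surj x : exists v, x = quotmod_pi v.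
Proof. by exists (repr (x : Quotient.quot submod_span_closed)); rewrite /quotmod_pi reprK. Qed.

Fact quotmod_scaleA a b x :
  quotmod_scale a (quotmod_scale b x) = quotmod_scale (a * b) x.
Proof. by case: (quotmod_surj x) => v ->; rewrite !quotmod_piZ scalerA. Qed.

Fact quotmod_scale1 : left_id 1 quotmod_scale.
Proof. by move=> x; case: (quotmod_surj x) => v ->; rewrite quotmod_piZ scale1r. Qed.

Fact quotmod_scaleDr : right_distributive quotmod_scale +%R.
Proof.
move=> c x y; case: (quotmod_surj x) (quotmod_surj y) => u -> [v ->].
by rewrite -quotmod_piD !quotmod_piZ scalerDr quotmod_piD.
Qed.

Fact quotmod_scaleDl x : {morph quotmod_scale^~ x : a b / a + b}.
Proof.
move=> a b; case: (quotmod_surj x) => v ->.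
by rewrite !quotmod_piZ scalerDl quotmod_piD.
Qed.

HB.instance Definition _ := GRing.Zmodule_isLmodule.Build R quotmod
  quotmod_scaleA quotmod_scale1 quotmod_scaleDr quotmod_scaleDl.

End QuotientModule.

(* Each relation is imposed on every surface with its
   boundary, so the spans below are stable under gluing and no closure under
   composition has to be added. *)

Section Hom.
Variables (R : comPzRingType) (n m : nat).

Definition lincob : lmodType R := freemod R (cobordism n m).

Definition surf (C : surface n m) : lincob := basis_vec R (cob_of C).

Variant rel_4TU : lincob -> Prop :=
  Rel4TU (C : surface n m) (D1 D2 D3 D4 : component C) :
    rel_4TU (surf (tube D1 D2) + surf (tube D3 D4)
             - (surf (tube D1 D3) + surf (tube D2 D4))).

Variant rel_loc : lincob -> Prop :=
| RelLoc4TU v of rel_4TU v : rel_loc v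
| RelLocS (C : surface n m) : rel_loc (surf (add_closed C 0))
| RelLocT (C : surface n m) : rel_loc (surf (add_closed C 1) - 2%:R *: surf C).

Definition Hom_4TU : lmodType R := quotmod rel_4TU.
Definition Hom_loc : lmodType R := quotmod rel_loc.

Definition cl_4TU (v : lincob) : Hom_4TU := quotmod_pi rel_4TU v.
Definition cl_loc (v : lincob) : Hom_loc := quotmod_pi rel_loc v.

End Hom.

(* Main.v *)
(* Write (i, j) for Sigma with the genera of A and B increased by i and j, and
   [k] for Sigma with A and B replaced by their connected sum of genus
   g(A) + g(B) + k.  The 4TU relation with two disks on A and two on B reads
   (i+1, j) + (i, j+1) = 2 [i+j].  Subtracting its instances at (1, 0) and
   (0, 1) gives (2, 0) = (0, 2). *)
Require Import Defs.
From mathcomp Require Import all_boot all_order all_algebra.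
From mathcomp Require Import boolp.

Import GRing.Theory.
Local Open Scope ring_scope.

Lemma submod_span_gen (R : pzRingType) (V : lmodType R) (P : V -> Prop) v :
  P v -> submod_span P v.
Proof.
move=> Pv; apply/asboolP; exists 1%N, (fun=> 1), (fun=> v); split=> //.
by rewrite big_ord1 scale1r.
Qed.

Section AddGenus.
Variables (n m : nat) (C : surface n m).
Implicit Types a b : component C.

Lemma add_genus_add a g h :
  @add_genus n m (add_genus a g) a h = add_genus a (g + h).
Proof.
congr (@Surface _ _ _ _ _); apply/ffunP=> x; rewrite !ffunE -addnA.
by case: eqP.
Qed.

Lemma add_genusC a b g h :
  @add_genus n m (add_genus a g) b h = @add_genus n m (add_genus b h) a g.
Proof.
by congr (@Surface _ _ _ _ _); apply/ffunP=> x; rewrite !ffunE addnAC.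
Qed.

Lemma tube_same a : tube a a = add_genus a 1.
Proof. by rewrite /tube unlift_none. Qed.

(** Genera add under connected sum, so the result does not record which summand carried [g]. *)
Lemma tube_add_genus a b g : a <> b ->
  @tube n m (add_genus a g) a b = @tube n m (add_genus b g) a b.
Proof.
move=> /eqP ab; rewrite /tube /=.
case: unliftP => [a' def_a|eq_ab]; last by rewrite eq_ab eqxx in ab.
congr (@Surface _ _ _ _ _); apply/ffunP=> x; rewrite !ffunE eqxx.
(* No surviving index [lift b x] equals [b], so on the right [g] enters only through the genus
   transferred to [a']. *)
rewrite [b == a]eq_sym (negPf ab) [_ == b]eq_sym (negPf (neq_lift b x)).
rewrite def_a (inj_eq lift_inj) !addn0.
by case: eqP => _; rewrite ?addn0 // addnAC addnA.
Qed.

End AddGenus.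

(** [P] is kept general to serve both [rel_4TU] and [rel_loc]. *)
Lemma two_handle_span (R : comPzRingType) (n m : nat)
    (P : lincob R n m -> Prop) (Sigma : surface n m) (A B : component Sigma) :
  (forall v, rel_4TU v -> P v) -> A <> B ->
  submod_span P (surf R (add_genus A 2) - surf R (add_genus B 2)).
Proof.
move=> sub neqAB.
(* With disks on [A], [A], [B], [B], tubes 12 and 34 add handles, while 13 and 24 both join [A] to
   [B]. *)
have relA := submod_span_gen _ _ _ _ (sub _ (Rel4TU R (C := add_genus A 1) A A B B)).
have relB := submod_span_gen _ _ _ _ (sub _ (Rel4TU R (C := add_genus B 1) A A B B)).
move: relA relB; rewrite !tube_same !add_genus_add tube_add_genus //.
rewrite (add_genusC _ _ _ A B) addn1 => relA relB.
(* Here [x], [y], [z] are (2, 0), (1, 1), (0, 2), and [t] is the doubled connected sum. *)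
have cancel (V : zmodType) (x y z t : V) : (x + y - t) - (y + z - t) = x - z.
  by rewrite opprB addrA subrK [y + z]addrC opprD addrA addrAC addrK.
have := (submod_span_zmod_closed P).2 _ _ relA relB.
by rewrite cancel.
Qed.

Theorem lemma2p1 (R : comPzRingType) (n m : nat) (Sigma : surface n m)
    (A B : component Sigma) (neqAB : A <> B) :
  cl_4TU (surf R (add_genus A 2)) = cl_4TU (surf R (add_genus B 2)) /\
  cl_loc (surf R (add_genus A 2)) = cl_loc (surf R (add_genus B 2)).
Proof.
split; apply/quotmod_eqP; apply: two_handle_span => // v.
exact: RelLoc4TU.
Qed.
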